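(* The following statements hold. (1) Asymptotically as $q\to\infty$, each of the ratios $$\frac{\max_i f_i(\mathbb{T}^3_q)}{\max_i f_i(\mathbb{S}^3_q)}\qquad\text{and}\qquad\frac{\max_i f_i(\mathbb{L}^3_q)}{\max_i f_i(\mathbb{S}^3_q)}$$ is equal to $\dfrac{2^{q^2+O(q)}}{\sqrt{1+6/q}}$. (2) Fix $0\le c<1$ and define $i=c(\dim(\mathbb{S}^3_q)+1)$ (with $q$ ranging over the values for which $i$ is an integer). Then, asymptotically as $q\to\infty$, each of the ratios $$\frac{f_{i-1}(\mathbb{T}^3_q)}{f_{i-1}(\mathbb{S}^3_q)}\qquad\text{and}\qquad\frac{f_{i-1}(\mathbb{L}^3_q)}{f_{i-1}(\mathbb{S}^3_q)}$$ is equal to $$\left(\frac{1}{1-c}\right)^{q^2+O(q)}O\!\left(\exp\left(\frac{-3cq}{1-c}\right)\right).$$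
   Context: $f_i(\Delta)$ denotes the number of $i$-dimensional faces of a simplicial complex $\Delta$ (with $f_{-1}(\Delta)=1$). Let $\mathsf{k}$ be a field, $[q]=\{1,\dots,q\}$, and $\mathcal{N}^r_q=\{\mathbf a\in\mathbb{N}^q : a_1+\cdots+a_q=r\}$. The $q$-extremal ideal $\mathcal{E}_q$ is the ideal of $\mathsf{k}[x_A : \emptyset\ne A\subseteq[q]]$ generated by $\epsilon_i=\prod_{A\ni i}x_A$, $i\in[q]$. Its power $\mathcal{E}_q^{\,r}$ is minimally generated by the monomials $\epsilon^{\mathbf a}=\epsilon_1^{a_1}\cdots\epsilon_q^{a_q}$, $\mathbf a\in\mathcal{N}^r_q$. The Taylor complex $\mathbb{T}^r_q$ is the full simplex on $\mathcal{N}^r_q$, each face $\sigma$ being labeled by $\mathbf{m}_\sigma=\mathrm{lcm}(\epsilon^{\mathbf a}:\mathbf a\in\sigma)$. The Scarf complex $\mathbb{S}^r_q$ is the subcomplex of all $\sigma$ with $\mathbf{m}_\sigma\ne\mathbf{m}_\tau$ for every $\tau\subseteq\mathcal{N}^r_q$, $\tau\neq\sigma$. $\mathbb{L}^3_q$ is a simplicial complex from earlier work with $\mathbb{S}^3_q\subseteq\mathbb{L}^3_q\subseteq\mathbb{T}^3_q$; it enters only through its face numbers $f_i(\mathbb{L}^3_q)=q\binom{q-1}{i}+\binom{\binom{q}{3}+2\binom{q}{2}}{i+1}$ for $i\ge 0$. For comparison, $f_i(\mathbb{T}^3_q)=\binom{\binom{q+2}{3}}{i+1}$. *)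

(* Defs.v *)
From mathcomp Require Import all_boot all_order all_algebra.
From mathcomp Require Import mpoly.

Set Implicit Arguments.
Unset Strict Implicit.
Unset Printing Implicit Defensive.

Local Open Scope nat_scope.

Section SimplicialComplexes.

Variable V : finType.
Implicit Types D : {set {set V}}.

Definition simplicial_complex D : Prop :=
  set0 \in D /\ forall s t : {set V}, s \in D -> t \subset s -> t \in D.

(* The index is an integer, so that i = -1 (which counts the empty face) is
   allowed. *)
Definition face_num D (i : int) : nat :=
  #|[set s in D | (#|s|%:Z == i + 1)%R]|.

Definition dim_complex D : int := ((\max_(s in D) #|s|)%:Z - 1)%R.

(* Faces have at most #|V| vertices, so this is the maximum over all i >= 0. *)
Definition max_face_num D : nat := \max_(i < #|V|) face_num D i%:Z.

End SimplicialComplexes.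

Section ExtremalIdeals.

Variable q : nat.

(* One variable x_A for each nonempty A; the j-th variable of the monomial
   type is x_A for A = val (enum_val j). *)
Definition var_index : finType := {A : {set 'I_q} | A != set0}.

Definition ext_monomial := 'X_{1..#|var_index|}.

(* Labels are monomials, i.e. exponent vectors, written additively in
   multinomials; the field of coefficients plays no role. *)
Definition ext_gen (i : 'I_q) : ext_monomial :=
  [multinom (i \in val (enum_val j) : nat) | j < #|var_index|].

Definition ext_gen_pow (a : 'X_{1..q}) : ext_monomial :=
  (\sum_(i < q) ext_gen i *+ a i)%MM.

Variable r : nat.

(* The ambient finite type of exponent vectors of degree at most r. *)
Definition vertex : finType := 'X_{1..q < r.+1}.

Definition Nrq : {set vertex} := [set a : vertex | mdeg a == r].

Definition label (s : {set vertex}) : ext_monomial :=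
  \big[@mlcm #|var_index|/0%MM]_(a in s) ext_gen_pow a.

Definition taylor : {set {set vertex}} := powerset Nrq.

Definition scarf : {set {set vertex}} :=
  [set s in taylor |
    [forall t in taylor, (t != s) ==> (label s != label t)]].

End ExtremalIdeals.

(* The properties of the complex L^3_q that are used: it lies between the Scarf
   and the Taylor complexes and has the prescribed face numbers. *)
Definition is_L3 (q : nat) (L : {set {set vertex q 3}}) : Prop :=
  [/\ simplicial_complex L,
      scarf q 3 \subset L,
      L \subset taylor q 3 &
      forall i : nat,
        face_num L i%:Z
          = q * 'C(q.-1, i) + 'C('C(q, 3) + 2 * 'C(q, 2), i.+1)].

(* Main.v *)
Require Import Defs.
From mathcomp Require Import all_boot all_order all_algebra.
From mathcomp Require mpoly.
From mathcomp Require Import zify ring lra.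
Set Implicit Arguments.
Unset Strict Implicit.
Unset Printing Implicit Defensive.

(** Write K = 'C(q, 3).  A vertex of degree 3 is either squarefree,
    e_i + e_j + e_k with i, j, k distinct (there are K of these), or of the
    form 2 e_i + e_j with i = j allowed (there are q ^ 2 of these); so the
    Taylor complex is a simplex on N = K + q ^ 2 vertices, and the number
    M = K + q ^ 2 - q occurring in the face numbers of L counts the vertices
    other than the cubes 3 e_i.  The point is that the Scarf complex is, up to a
    factor 2 ^ q, no larger than the simplex on the K squarefree vertices:
      'C(K, n) <= f_(n-1)(Scarf) <= 2 ^ q * 'C(K, n)    for q >= 15
    ([scarf_faces_ge], [scarf_faces_le]), hence also dim + 1 = K ([dim_scarf]).

    A set s of exponent vectors is a Scarf face iff every exponent vector b of
    degree 3 has a set A of indices with a(A) < b(A) for all a in s other than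
    b, where a(A) is the sum of the a_i over i in A ([scarf_separated],
    [separated_scarf]).  From squarefree vertices, A = supp b separates a
    squarefree b and A = [set i] separates 2 e_i + e_j, so every set of
    squarefree vertices is a face: this is the lower bound.  Conversely, if
    2 e_i + e_j is in s then every squarefree vertex of s that involves j
    involves i too ([scarf_target]).  So each index j that is the simple index
    of some 2 e_i + e_j in s (a target) leaves at most q squarefree vertices
    through j instead of about q ^ 2 / 2, which outweighs the q vertices
    2 e_i + e_j that it brings in.  Precisely, the faces with a given set T of
    targets are encoded injectively, and preserving size, as subsets of a set
    with at most K elements; there are 2 ^ q sets T.

    The theorem follows because an error of size 2 ^ O(q) or expR O(q) in a
    ratio can be absorbed into the function g ([exponent_exists]).  For the
    maxima one uses that max_n 'C(m, n) lies between 2 ^ m / (m + 1) and 2 ^ m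
    ([max_face_num_ratio]); the square root lies between 1 and 2.  For the
    second part, n = c * K, and 'C(K + m, n) / 'C(K, n) is a product of m
    factors (K + k) / (K + k - n).  Each is at most 1 / (1 - c), and smaller
    only by a factor 1 + O(m / K) ([bin_ratio_le], [bin_ratio_ge]); with
    m <= q ^ 2 and K of order q ^ 3, the total loss is expR O(q).  The factor
    h is taken to be exactly expR (- 3 c q / (1 - c)), except for c = 0, where
    the base 1 / (1 - c) is 1 and h is the ratio itself. *)

Local Open Scope nat_scope.

(** * Scarf faces of powers of extremal ideals *)

Section Criterion.
Variables q r : nat.
Implicit Types (a b : vertex q r) (A : {set 'I_q}) (s t : {set vertex q r}).

(** Coordinates of an exponent vector; later arguments about vertices go through
    [expo] and never unfold the multinomial encoding. *)
Definition expo a (i : 'I_q) : nat := mpoly.fun_of_multinom (mpoly.bmnm a) i.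

(** The exponent of the variable x_A in the monomial epsilon^a. *)
Definition weight a A : nat := \sum_(i in A) expo a i.

Lemma expo_inj a b : expo a =1 expo b -> a = b.
Proof. by move=> /mpoly.mnmP e; apply/eqP; rewrite mpoly.bmeqP; apply/eqP. Qed.

Lemma Nrq_weight a : (a \in Nrq q r) = (weight a setT == r).
Proof.
rewrite inE mpoly.mdegE /weight; congr (_ == _).
by apply: eq_bigl => i; rewrite inE.
Qed.

Lemma ext_gen_powE a j :
  mpoly.fun_of_multinom (ext_gen_pow (mpoly.bmnm a)) j = weight a (val (enum_val j)).
Proof.
rewrite /ext_gen_pow mpoly.mnm_sumE /weight [RHS]big_mkcond /=.
apply: eq_bigr => i _; rewrite mpoly.mulmnE /ext_gen mpoly.mnmE.
by case: ifP => _; rewrite ?mul1n ?mul0n.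
Qed.

Lemma labelE s j :
  mpoly.fun_of_multinom (label s) j = \max_(a in s) weight a (val (enum_val j)).
Proof.
rewrite /label (big_morph (fun m : ext_monomial q => mpoly.fun_of_multinom m j)
  (id1 := 0) (op1 := maxn)).
- by apply: eq_bigr => a _; rewrite ext_gen_powE.
- by move=> m m'; rewrite mpoly.mnmE.
- by rewrite mpoly.mnm0E.
Qed.

Lemma max_weight_label s t A : label s = label t -> A != set0 ->
  \max_(a in s) weight a A = \max_(a in t) weight a A.
Proof.
move=> e A0; have := labelE s (enum_rank (Sub A A0 : var_index q)).
by rewrite e labelE enum_rankK.
Qed.

(** If no A separates b from s, then epsilon^b divides the label of s :\ b, so
    b |: s and s :\ b have the same label; one of them is different from s, and
    the other is s. *)
Lemma scarf_separated s b : s \in scarf q r -> b \in Nrq q r ->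
  exists A, forall a, a \in s -> a != b -> weight a A < weight b A.
Proof.
rewrite inE => /andP[sT /forall_inP sS] bN.
case: (boolP [exists A, [forall a in s, (a != b) ==> (weight a A < weight b A)]]).
  by move=> /existsP[A /forall_inP h]; exists A => a /h /implyP.
rewrite negb_exists => /forallP h.
have tT t : t \subset b |: s -> t \in taylor q r.
  move=> /subset_trans tb; rewrite inE; apply: tb.
  by rewrite subUset sub1set bN; rewrite inE in sT.
have eqL : label (b |: s) = label (s :\ b).
  apply/mpoly.mnmP => j; rewrite !labelE; set A := val _.
  have -> : b |: s = b |: (s :\ b) by apply/setP => x; rewrite !inE; case: eqP.
  rewrite big_setU1 ?setD11 //=; apply/maxn_idPr.
  have := h A; rewrite negb_forall => /existsP[a]; rewrite negb_imply negb_imply.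
  move=> /and3P[sa ab]; rewrite -leqNgt => /leq_trans; apply.
  have aD : a \in s :\ b by rewrite !inE ab.
  exact: (leq_bigmax_cond (F := weight^~ A) _ aD).
have [bs|bs] := boolP (b \in s).
- have /sS : s :\ b \in taylor q r by apply: tT; rewrite (subset_trans (subD1set _ _)) ?subsetUr.
  have -> : s :\ b != s by apply: contraTneq bs => <-; rewrite !inE eqxx.
  have e : b |: s = s by apply/setUidPr; rewrite sub1set.
  by rewrite -eqL e eqxx.
- have /sS : b |: s \in taylor q r by apply: tT.
  have -> : b |: s != s by apply: contraNneq bs => <-; rewrite !inE eqxx.
  rewrite eqL; have -> : s :\ b = s; last by rewrite eqxx.
  by apply/setDidPl; rewrite disjoint_sym disjoints1.
Qed.

(** A set t with the label of s cannot contain b outside s, whose exponent at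
    the separating A would be too large, nor miss an element b of s, whose
    exponent at A is attained by no other element of s.  Positivity of the
    weight excludes A = set0, which indexes no variable. *)
Lemma separated_scarf s : s \subset Nrq q r ->
    (forall b, b \in Nrq q r -> exists2 A, 0 < weight b A &
       forall a, a \in s -> a != b -> weight a A < weight b A) ->
  s \in scarf q r.
Proof.
move=> sN sep; rewrite inE; apply/andP; split; first by rewrite inE.
apply/forall_inP => t; rewrite inE => tN; apply/implyP; apply: contraNneq => eL.
have max_lt (u : {set vertex q r}) b A : 0 < weight b A ->
    (forall a, a \in u -> weight a A < weight b A) -> \max_(a in u) weight a A < weight b A.
  move=> b0 hu; elim/big_ind: _ => //.
  by move=> m m' ? ?; rewrite gtn_max; apply/andP.
have A0 b A : 0 < weight b A -> A != set0.
  by apply: contraTneq => ->; rewrite /weight big_set0.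
have ts : t \subset s.
  apply/subsetP => b bt; have bN := subsetP tN _ bt.
  apply/negPn/negP => bs; have [A b0 hA] := sep _ bN.
  have /max_lt - /(_ b0) : forall a, a \in s -> weight a A < weight b A.
    by move=> a sa; apply: hA => //; apply: contraNneq bs => <-.
  rewrite (max_weight_label eL (A0 _ _ b0)) ltnNge => /negP; apply.
  exact: (leq_bigmax_cond (F := weight^~ A) _ bt).
rewrite eqEsubset ts; apply/subsetP => b bs; have bN := subsetP sN _ bs.
apply/negPn/negP => bt; have [A b0 hA] := sep _ bN.
have /max_lt - /(_ b0) : forall a, a \in t -> weight a A < weight b A.
  move=> a ta; apply: hA; first exact: (subsetP ts).
  by apply: contraNneq bt => <-.
rewrite -(max_weight_label eL (A0 _ _ b0)) ltnNge => /negP; apply.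
exact: (leq_bigmax_cond (F := weight^~ A) _ bs).
Qed.

End Criterion.

Lemma vertex_exists q r (f : 'I_q -> nat) :
  \sum_i f i <= r -> {a : vertex q r | expo a =1 f}.
Proof.
move=> fr; pose m : mpoly.multinom q := mpoly.Multinom [tuple f i | i < q].
have mE i : mpoly.fun_of_multinom m i = f i by rewrite mpoly.mnmE.
have mr : mpoly.mdeg m < r.+1.
  by rewrite ltnS mpoly.mdegE (eq_bigr f) // => i _; rewrite mE.
by exists (mpoly.BMultinom mr).
Qed.

(** * Vertices of degree three *)

Section Cubic.
Variable q : nat.
Implicit Types (a b : vertex q 3) (i j k l x : 'I_q) (A : {set 'I_q}).
Implicit Types (s t : {set vertex q 3}).

Lemma sum_eq_in i A : \sum_(x in A) (i == x : nat) = (i \in A).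
Proof.
have [iA|iA] := boolP (i \in A).
  rewrite (bigD1 i) //= eqxx big1 // => x /andP[_ xi].
  by rewrite eq_sym (negbTE xi).
by rewrite big1 // => x xA; case: eqP iA => // ->; rewrite xA.
Qed.

Fact vert3_subproof i j k : \sum_x ((i == x) + (j == x) + (k == x)) <= 3.
Proof.
have e l : \sum_x (l == x : nat) = 1.
  have := sum_eq_in l setT; rewrite inE /= => <-.
  by apply: eq_bigl => x; rewrite inE.
by rewrite !big_split /= !e.
Qed.

Definition vert3 i j k : vertex q 3 := sval (vertex_exists (vert3_subproof i j k)).

Lemma vert3E i j k x : expo (vert3 i j k) x = (i == x) + (j == x) + (k == x).
Proof. by rewrite /vert3; case: vertex_exists => a /= ->. Qed.

Lemma weight_vert3 i j k A :
  weight (vert3 i j k) A = (i \in A) + (j \in A) + (k \in A).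
Proof.
rewrite /weight (eq_bigr _ (fun x _ => vert3E i j k x)).
by rewrite !big_split /= !sum_eq_in.
Qed.

Lemma vert3_Nrq i j k : vert3 i j k \in Nrq q 3.
Proof. by rewrite Nrq_weight weight_vert3 !inE. Qed.

Lemma sum_peel d (f : 'I_q -> nat) : \sum_i f i = d.+1 ->
  exists i, exists2 g : 'I_q -> nat, \sum_i g i = d &
    forall x, f x = (i == x) + g x.
Proof.
move=> fd; have [i fi] : exists i, 0 < f i.
  have [i fi|f0] := pickP (fun i => 0 < f i); first by exists i.
  by move: fd; rewrite big1 // => i _; have := f0 i; case: (f i).
exists i, (fun x => f x - (i == x)) => [|x]; last first.
  by case: eqP => [<-|_]; lia.
move: fd; rewrite (bigD1 i) //= (bigD1 i (F := fun x => f x - _)) //= eqxx.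
have -> : \sum_(x | x != i) (f x - (i == x)) = \sum_(x | x != i) f x.
  by apply: eq_bigr => x xi; rewrite eq_sym (negbTE xi) subn0.
by case: (f i) fi => // m _; rewrite addSn /= subn1 => -[].
Qed.

Lemma Nrq3P a : a \in Nrq q 3 -> exists i j k, a = vert3 i j k.
Proof.
rewrite Nrq_weight => /eqP; rewrite /weight (eq_bigl xpredT) => [|x]; last by rewrite inE.
move=> /sum_peel[i [g /sum_peel[j [h /sum_peel[k [m m0 eh]] eg]] ef]].
exists i, j, k; apply: expo_inj => x; rewrite vert3E ef eg eh.
have -> : m x = 0; last by lia.
by apply/eqP; move/eqP: m0; rewrite sum_nat_eq0 => /forallP /(_ x).
Qed.

(** The case i = j is included: all the vertices that are not squarefree,
    cubes or not, are then treated together. *)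
Definition dbl i j := vert3 i i j.

Lemma dblE i j x : expo (dbl i j) x = (i == x).*2 + (j == x).
Proof. by rewrite vert3E addnn. Qed.

Lemma dbl_inj i j k l : dbl i j = dbl k l -> i = k /\ j = l.
Proof.
move=> e; have ex x : (i == x).*2 + (j == x) = (k == x).*2 + (l == x).
  by rewrite -!dblE e.
move: (ex i) (ex j); rewrite !eqxx [j == i]eq_sym.
by do 2![case: eqP => [<-|_]]; do ?case: eqP => [->|_].
Qed.

Definition sqfree : {set vertex q 3} :=
  [set a in Nrq q 3 | [forall i, expo a i <= 1]].

Definition supp a : {set 'I_q} := [set i | 0 < expo a i].

Lemma dbl_sqfree i j : dbl i j \notin sqfree.
Proof.
rewrite inE vert3_Nrq /=; apply/negP => /forallP /(_ i).
by rewrite dblE eqxx.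
Qed.

Lemma Nrq3_cases a : a \in Nrq q 3 -> a \notin sqfree -> exists i j, a = dbl i j.
Proof.
move=> aN; have [i [j [k e]]] := Nrq3P aN; rewrite inE aN /= negb_forall.
move=> /existsP[x]; rewrite e vert3E => h.
have [ij|ij] := eqVneq i j; first by exists i, k; rewrite ij.
have [ik|ik] := eqVneq i k.
  by exists i, j; apply: expo_inj => y; rewrite ik !vert3E; lia.
have [jk|jk] := eqVneq j k.
  by exists j, i; apply: expo_inj => y; rewrite jk !vert3E; lia.
case: (eqVneq i x) h => [<-|_].
  by rewrite ![_ == i]eq_sym (negbTE ij) (negbTE ik).
case: (eqVneq j x) => [<-|_]; first by rewrite [_ == j]eq_sym (negbTE jk).
by case: eqP.
Qed.

Lemma sqfreeE a i : a \in sqfree -> expo a i = (i \in supp a).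
Proof. by rewrite !inE => /andP[_ /forallP /(_ i)]; case: (expo a i) => [|[]]. Qed.

Lemma sqfree_weight a A : a \in sqfree -> weight a A = #|A :&: supp a|.
Proof.
move=> aS; rewrite /weight (eq_bigr _ (fun i _ => sqfreeE i aS)).
rewrite -sum1_card big_mkcond /= [RHS]big_mkcond; apply: eq_bigr => i _.
by rewrite in_setI; case: (i \in A); case: (i \in supp a).
Qed.

Lemma card_supp a : a \in sqfree -> #|supp a| = 3.
Proof.
move=> aS; rewrite -[supp a]setTI -sqfree_weight //; apply/eqP.
by rewrite -Nrq_weight; move: aS; rewrite inE => /andP[].
Qed.

Lemma supp_inj : {in sqfree &, injective supp}.
Proof. by move=> a b aS bS e; apply: expo_inj => i; rewrite !sqfreeE // e. Qed.

Lemma sqfree_at a j : a \in sqfree -> j \in supp a ->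
  exists k l, [/\ j != k, j != l, k != l & a = vert3 j k l].
Proof.
move=> aS ja; have := card_supp aS; rewrite (cardsD1 j) ja add1n => -[c2].
have /cards2P[k [l [kl e]]] : #|supp a :\ j| == 2 by rewrite c2.
have [] : k \in supp a :\ j /\ l \in supp a :\ j by rewrite e !inE !eqxx orbT.
rewrite !in_setD1 ![_ == j]eq_sym => /andP[jk _] /andP[jl _].
exists k, l; split=> //; apply: expo_inj => x; rewrite vert3E sqfreeE //.
have -> : supp a = j |: [set k; l] by rewrite -e setD1K.
rewrite !inE ![x == _]eq_sym.
case: (eqVneq j x) => [<-|_];
  first by rewrite [k == j]eq_sym [l == j]eq_sym (negbTE jk) (negbTE jl).
by case: (eqVneq k x) => [<-|_]; first by rewrite [l == k]eq_sym (negbTE kl).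
Qed.

Lemma card_sqfree_on A : #|[set a in sqfree | supp a \subset A]| = 'C(#|A|, 3).
Proof.
rewrite -cards_draws.
rewrite -(@card_in_imset _ _ supp) => [|a b]; last first.
  by move=> /setIdP[aS _] /setIdP[bS _]; apply: supp_inj.
congr #|pred_of_set _|; apply/setP => B; rewrite inE.
apply/imsetP/andP => [[a]|[BA /eqP B3]].
  by move=> /setIdP[aS aA] ->; rewrite card_supp.
have [|a ea] := @vertex_exists q 3 (fun i => i \in B : nat).
  by rewrite -big_mkcond sum1_card B3.
have eB : supp a = B by apply/setP => i; rewrite inE ea lt0b.
exists a => //; rewrite inE eB BA andbT inE Nrq_weight.
apply/andP; split; last by apply/forallP => i; rewrite ea leq_b1.
rewrite /weight (eq_bigr _ (fun i _ => ea i)) (eq_bigl xpredT) => [|i].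
  by rewrite -big_mkcond sum1_card B3.
by rewrite inE.
Qed.

Lemma card_sqfree : #|sqfree| = 'C(q, 3).
Proof.
rewrite -[in RHS](card_ord q) -cardsT -card_sqfree_on.
by apply: eq_card => a; rewrite !inE subsetT andbT.
Qed.

Lemma card_Nrq3 : #|Nrq q 3| = 'C(q, 3) + q ^ 2.
Proof.
have -> : Nrq q 3 = sqfree :|: [set dbl p.1 p.2 | p in [set: 'I_q * 'I_q]].
  apply/setP => a; rewrite in_setU; apply/idP/orP.
    move=> aN; have [|aS] := boolP (a \in sqfree); [by left|right].
    have [i [j ->]] := Nrq3_cases aN aS.
    by apply/imsetP; exists (i, j); rewrite ?inE.
  by case=> [|/imsetP[p _ ->]]; [rewrite inE => /andP[]|apply: vert3_Nrq].
rewrite cardsU disjoint_setI0 ?cards0 ?subn0.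
  rewrite card_sqfree card_imset ?cardsT ?card_prod ?card_ord ?mulnn //.
  by move=> [i j] [k l] /= /dbl_inj[-> ->].
rewrite disjoint_sym disjoints_subset; apply/subsetP => _ /imsetP[p _ ->].
by rewrite inE dbl_sqfree.
Qed.

Lemma sub_sqfree_scarf s : s \subset sqfree -> s \in scarf q 3.
Proof.
move=> sS; apply: separated_scarf => [|b bN].
  by apply/subsetP => a /(subsetP sS); rewrite inE => /andP[].
have [bS|bS] := boolP (b \in sqfree).
  exists (supp b) => [|a /(subsetP sS) aS ab].
    by rewrite sqfree_weight // setIid card_supp.
  rewrite !sqfree_weight // setIid proper_card // properEneq subsetIl andbT.
  apply: contraNneq ab => /setIidPl sub; apply/eqP/supp_inj => //.
  by apply/esym/eqP; rewrite eqEcard sub !card_supp.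
have [i [j ->]] := Nrq3_cases bN bS.
exists [set i] => [|a /(subsetP sS) aS _]; rewrite weight_vert3 in_set1 eqxx //.
by rewrite sqfree_weight // (leq_ltn_trans (subset_leq_card (subsetIl _ _))) ?cards1.
Qed.

(** Let a = e_j + e_k + e_l.  If i = j, no A separates 2 e_j + e_k from both
    dbl j j and a; if i <> j, none separates e_i + e_j + e_k from both dbl i j
    and a, unless i is k or l. *)
Lemma scarf_target s i j a : s \in scarf q 3 -> dbl i j \in s ->
  a \in s -> a \in sqfree -> j \in supp a -> i != j /\ i \in supp a.
Proof.
move=> sS ijs as_ aS ja; have [k [l [jk jl kl e]]] := sqfree_at aS ja.
have [ij|ij] := eqVneq i j.
  rewrite {}ij in ijs; have [A hA] := scarf_separated sS (vert3_Nrq j j k).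
  have := hA _ ijs; have := hA _ as_.
  have -> : a != vert3 j j k by apply: contraNneq (dbl_sqfree j k) => ax; rewrite /dbl -ax.
  have -> : dbl j j != vert3 j j k by apply: contraNneq jk => /dbl_inj[_ ->].
  rewrite e !weight_vert3 => /(_ isT) h1 /(_ isT) h2.
  by move: h1 h2; case: (j \in A); case: (k \in A); case: (l \in A).
split=> //; apply/negPn/negP => ix.
have [A hA] := scarf_separated sS (vert3_Nrq i j k).
have := hA _ ijs; have := hA _ as_.
have -> : a != vert3 i j k.
  by apply: contraNneq ix => ->; rewrite inE vert3E eqxx.
have -> : dbl i j != vert3 i j k.
  apply/eqP => /(congr1 (fun b => expo b i)); rewrite dblE vert3E eqxx.
  rewrite eq_sym (negbTE ij); case: eqP => // ki.
  by move: ix; rewrite e inE vert3E ki eqxx addn1.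
rewrite e !weight_vert3 => /(_ isT) h1 /(_ isT) h2.
by move: h1 h2; do 4!case: (_ \in A).
Qed.

End Cubic.

(** * Counting the faces of the Scarf complex *)

Lemma face_num_card (V : finType) (D : {set {set V}}) n :
  face_num D (n%:Z - 1)%R = #|[set s in D | #|s| == n]|.
Proof. by rewrite /face_num; apply: eq_card => s; rewrite !inE GRing.subrK. Qed.

Lemma bin3_ffact n : 6 * 'C(n, 3) = n * (n - 1) * (n - 2).
Proof. by rewrite mulnC (bin_ffact n 3) !ffactnSr ffactn0 subn0 mul1n. Qed.

Section Encoding.
Variable q : nat.
Implicit Types (a b : vertex q 3) (i j k l x : 'I_q) (T : {set 'I_q}).
Implicit Types (s t : {set vertex q 3}) (p : 'I_q -> 'I_q).

Definition targets s : {set 'I_q} := [set j | [exists i, dbl i j \in s]].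

Definition source s j : 'I_q := odflt j [pick i | dbl i j \in s].

(** For T = targets s and p = source s.  A squarefree vertex of s through j in T
    also contains p j, so it is e_j + e_(p j) + e_l and the pair (j, l)
    determines it; all other vertices are kept.  Pairs with j in T are at most
    #|T| * q in number, which is what makes the code small. *)
Definition code T p a : vertex q 3 + 'I_q * 'I_q :=
  if a \in sqfree q then
    if [pick j in T :&: supp a] is Some j then
      inr (j, odflt j [pick l in supp a :\ j :\ p j])
    else inl a
  else inl a.

(** The property of the squarefree vertices of a Scarf face that makes the pair
    (j, l) sufficient to recover the vertex. *)
Definition anchored T p a : Prop :=
  a \in sqfree q -> forall j, j \in T -> j \in supp a -> p j != j /\ p j \in supp a.

Lemma code_inl T p a b : code T p a = inl b -> a = b.
Proof. by rewrite /code; case: ifP => _; [case: pickP => [j _|_]|] => // -[]. Qed.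

Lemma code_dbl T p i j : code T p (dbl i j) = inl (dbl i j).
Proof. by rewrite /code (negbTE (dbl_sqfree i j)). Qed.

Lemma code_inr T p a j l : anchored T p a -> code T p a = inr (j, l) ->
  [/\ a \in sqfree q, j \in T & supp a = [set j; p j; l]].
Proof.
rewrite /code; case: ifP => // aS anc; case: pickP => // j'.
rewrite inE => /andP[jT ja] [ej]; rewrite {}ej in jT ja *.
have [pj pa] := anc aS _ jT ja.
have c1 : #|supp a :\ j :\ p j| = 1.
  have := card_supp aS; rewrite (cardsD1 j) ja (cardsD1 (p j)) in_setD1 pj pa.
  by rewrite !add1n => -[].
have /cards1P[l' el] : #|supp a :\ j :\ p j| == 1 by rewrite c1.
rewrite el; case: pickP => [l'' /set1P ->|/(_ l')]; last by rewrite inE eqxx.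
move=> /= el'; split=> //.
rewrite -el' -setUA -el setD1K ?setD1K //.
by rewrite in_setD1 pj.
Qed.

Lemma code_inj T p a b : anchored T p a -> anchored T p b ->
  code T p a = code T p b -> a = b.
Proof.
move=> ha hb; case ea : (code T p a) => [c|[j l]] eb.
  by rewrite (code_inl ea) (code_inl (esym eb)).
have [aS _ sa] := code_inr ha ea; have [bS _ sb] := code_inr hb (esym eb).
by apply: supp_inj; rewrite // sa sb.
Qed.

Lemma scarf_anchored s a : s \in scarf q 3 -> a \in s ->
  anchored (targets s) (source s) a.
Proof.
move=> sS as_ aS j; rewrite inE => /existsP[i ijs] ja; rewrite /source.
case: pickP => [k kjs|/(_ i)]; last by rewrite ijs.
exact: (scarf_target sS kjs as_).
Qed.

Definition code_range T : {set vertex q 3 + 'I_q * 'I_q} :=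
  inl @: ([set a in sqfree q | supp a \subset ~: T]
          :|: [set dbl c.1 c.2 | c in setX setT T])
  :|: inr @: setX T setT.

Lemma card_code_range T : #|code_range T| <= 'C(q - #|T|, 3) + 2 * (#|T| * q).
Proof.
rewrite mul2n -addnn addnA.
apply: leq_trans (leq_card_setU _ _) _; apply: leq_add; last first.
  by rewrite (leq_trans (leq_imset_card _ _)) // cardsX cardsT card_ord.
apply: leq_trans (leq_imset_card _ _) _.
apply: leq_trans (leq_card_setU _ _) _; apply: leq_add.
  by rewrite card_sqfree_on cardsCs setCK card_ord.
by rewrite (leq_trans (leq_imset_card _ _)) // cardsX cardsT card_ord mulnC.
Qed.

Lemma code_in_range s a : s \in scarf q 3 -> a \in s ->
  code (targets s) (source s) a \in code_range (targets s).
Proof.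
move=> sS as_; have aN : a \in Nrq q 3.
  by move: sS; rewrite inE inE => /andP[/subsetP /(_ _ as_)].
have [aS|aS] := boolP (a \in sqfree q); last first.
  have [i [j e]] := Nrq3_cases aN aS.
  rewrite e code_dbl inE; apply/orP; left; apply/imset_f; rewrite inE.
  apply/orP; right; apply/imsetP; exists (i, j) => //; rewrite !inE /=.
  by apply/existsP; exists i; rewrite -e.
case e : code => [b|[j l]].
  rewrite inE; apply/orP; left; apply/imset_f; rewrite inE; apply/orP; left.
  rewrite -(code_inl e) inE aS /=; apply/subsetP => j ja; rewrite inE.
  apply/negP => jT; move: e; rewrite /code aS; case: pickP => // /(_ j).
  by rewrite !inE in jT ja *; rewrite jT ja.
have [_ jT _] := code_inr (scarf_anchored sS as_) e.
by rewrite inE; apply/orP; right; apply/imset_f; rewrite !inE /= in jT *; rewrite jT.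
Qed.

Lemma code_dblP s i j :
  (inl (dbl i j) \in code (targets s) (source s) @: s) = (dbl i j \in s).
Proof.
apply/imsetP/idP => [[a as_ /esym/code_inl <-] //|ijs].
by exists (dbl i j); rewrite ?code_dbl.
Qed.

(** The vertices dbl i j are encoded by themselves and by nothing else, so the
    image determines them; they determine the function [source], hence the
    code, which is injective on anchored vertices. *)
Lemma scarf_code_inj s t : s \in scarf q 3 -> t \in scarf q 3 ->
    targets s = targets t ->
    code (targets s) (source s) @: s = code (targets t) (source t) @: t ->
  s = t.
Proof.
move=> sS tS eT eC.
have eD i j : (dbl i j \in s) = (dbl i j \in t) by rewrite -!code_dblP eC.
have eP : source s =1 source t.
  by move=> j; rewrite /source (eq_pick (fun i => eD i j)).
have ec : code (targets s) (source s) =1 code (targets t) (source t).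
  move=> a; rewrite eT /code; case: ifP => // _; case: pickP => // j _.
  by rewrite eP.
have anc u a : u = s \/ u = t -> a \in u -> anchored (targets t) (source t) a.
  case=> -> au; last exact: scarf_anchored au.
  by move=> aS j; rewrite -eT -eP; apply: (scarf_anchored sS au).
have inc u v : u = s \/ u = t -> v = s \/ v = t ->
    code (targets t) (source t) @: u = code (targets t) (source t) @: v -> u \subset v.
  move=> hu hv e; apply/subsetP => a au.
  have := imset_f (code (targets t) (source t)) au; rewrite e => /imsetP[b bv eab].
  by rewrite (code_inj (anc _ _ hu au) (anc _ _ hv bv) eab).
rewrite (eq_imset _ ec) in eC.
by apply/eqP; rewrite eqEsubset !inc //; by [left | right].
Qed.

(** Let t = #|T| and m = q - t.  Since 6 * 'C(m, 3) <= m (q - 1) (q - 2), the t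
    targets cost at least t (q - 1) (q - 2) / 6 squarefree vertices; this is
    at least the gain 2 t q as soon as 12 q <= (q - 1) (q - 2), that is, from
    q = 15 on. *)
Lemma code_range_le T : 15 <= q -> #|code_range T| <= 'C(q, 3).
Proof.
move=> q15; apply: leq_trans (card_code_range T) _.
have : #|T| <= q by rewrite -[X in _ <= X](card_ord q) max_card.
move: #|T| => t tq.
have [m em] : exists m, q = m + t by exists (q - t); rewrite subnK.
have hq : 12 * q <= (q - 1) * (q - 2).
  have -> : q = q - 15 + 15 by rewrite subnK.
  by move: (q - 15) => z; rewrite -!addnBA //; nia.
have hm : m * (m - 1) * (m - 2) <= m * ((q - 1) * (q - 2)).
  by rewrite -mulnA !leq_mul // leq_sub2r // em leq_addr.
have hv : 6 * 'C(q, 3) = m * ((q - 1) * (q - 2)) + t * ((q - 1) * (q - 2)).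
  by rewrite bin3_ffact -mulnA -mulnDl -em.
have -> : q - t = m by rewrite em addnK.
rewrite -bin3_ffact in hm; have := leq_mul (leqnn t) hq.
move: ('C(m, 3)) ('C(q, 3)) (t * (_ * _)) (m * (_ * _)) hm hv => u v P P'.
by lia.
Qed.

(** The factor 2 ^ q counts the possible sets of targets. *)
Lemma scarf_faces_le n : 15 <= q ->
  face_num (scarf q 3) (n%:Z - 1)%R <= 2 ^ q * 'C('C(q, 3), n).
Proof.
move=> q15; rewrite face_num_card.
set S := [set s in _ | _].
rewrite -sum1_card (partition_big targets xpredT) //=.
have -> : 2 ^ q = #|{set 'I_q}| by rewrite -cardsT -powersetT card_powerset cardsT card_ord.
rewrite -sum_nat_const; apply: leq_sum => T _; rewrite sum1_card.
pose C s := code (targets s) (source s) @: s.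
have CI : {in [set s in S | targets s == T] &, injective C}.
  move=> s t /setIdP[/setIdP[sS _] /eqP sT] /setIdP[/setIdP[tS _] /eqP tT].
  by apply: scarf_code_inj => //; rewrite sT tT.
rewrite (_ : #|_| = #|C @: [set s in S | targets s == T]|); last first.
  by rewrite card_in_imset //; apply: eq_card => s; rewrite inE.
apply: (@leq_trans #|[set B : {set _} | B \subset code_range T & #|B| == n]|).
  apply/subset_leq_card/subsetP => _ /imsetP[s sS ->].
  move: sS => /setIdP[/setIdP[sS /eqP sn] /eqP sT].
  rewrite in_set; apply/andP; split.
    apply/subsetP => _ /imsetP[a as_ ->]; rewrite -sT; exact: code_in_range.
  rewrite card_in_imset ?sn // => a b as_ bs.
  by apply: code_inj; apply: scarf_anchored.
by rewrite cards_draws leq_bin2l // code_range_le.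
Qed.

Lemma scarf_faces_ge n :
  'C('C(q, 3), n) <= face_num (scarf q 3) (n%:Z - 1)%R.
Proof.
rewrite face_num_card -card_sqfree -cards_draws.
apply/subset_leq_card/subsetP => s /setIdP[sS sn].
by rewrite in_set sn andbT; apply: sub_sqfree_scarf.
Qed.

(** A face with more than 'C(q, 3) vertices would contradict the bound
    [scarf_faces_le], which is zero there. *)
Lemma dim_scarf : 15 <= q -> (dim_complex (scarf q 3) + 1)%R = Posz 'C(q, 3).
Proof.
move=> q15; rewrite /dim_complex GRing.subrK; congr Posz; apply/eqP.
rewrite eqn_leq; apply/andP; split.
  apply/bigmax_leqP => s sS; rewrite leqNgt; apply/negP => Ks.
  have := scarf_faces_le #|s| q15; rewrite (bin_small Ks) muln0 leqn0 face_num_card.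
  by apply/negP; rewrite -lt0n; apply/card_gt0P; exists s; rewrite in_set eqxx andbT.
rewrite -card_sqfree; apply: (leq_bigmax_cond (F := fun s : {set vertex q 3} => #|s|)).
exact: sub_sqfree_scarf.
Qed.

Lemma taylor_faces n :
  face_num (taylor q 3) (n%:Z - 1)%R = 'C('C(q, 3) + q ^ 2, n).
Proof.
rewrite face_num_card -card_Nrq3 -cards_draws.
by apply: eq_card => s; rewrite !inE.
Qed.

End Encoding.

(** * Maximal face numbers *)

Section MaxFaces.
Variables (V : finType) (D : {set {set V}}).

Lemma max_face_num_le c N :
    (forall n, face_num D (n%:Z - 1)%R <= c * 'C(N, n)) ->
  max_face_num D <= c * 2 ^ N.
Proof.
move=> h; apply/bigmax_leqP => i _.
have -> : Posz i = (Posz i.+1 - 1)%R by lia.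
apply: leq_trans (h _) _; rewrite leq_mul2l; apply/orP; right.
have [iN|Ni] := leqP i.+1 N; last by rewrite bin_small.
rewrite -[2]/(1 + 1) expnDn (bigD1 (Ordinal (iN : i.+1 < N.+1))) //= !exp1n !muln1.
exact: leq_addr.
Qed.

(** Every one of the M + 1 binomial coefficients that sum to 2 ^ M is at most
    the maximum: the one for the empty face, which the maximum leaves out, is
    'C(M, 0) = 1 <= 'C(M, 1). *)
Lemma max_face_num_ge M : 0 < M -> M <= #|V| ->
    (forall n, 'C(M, n) <= face_num D (n%:Z - 1)%R) ->
  2 ^ M <= M.+1 * max_face_num D.
Proof.
move=> M0 MV h.
have hmax n : 0 < n <= M -> 'C(M, n) <= max_face_num D.
  case: n => // n nM; apply: leq_trans (h _) _.
  have -> : (Posz n.+1 - 1)%R = Posz n by lia.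
  exact: (leq_bigmax_cond (F := fun i : 'I_#|V| => face_num D i)
            (Ordinal (leq_trans nM MV))).
have -> : M.+1 * max_face_num D = \sum_(i < M.+1) max_face_num D.
  by rewrite sum_nat_const card_ord.
rewrite -[2]/(1 + 1) expnDn; apply: leq_sum => -[[|n] nM] _ /=; rewrite !exp1n !muln1.
  by rewrite bin0 -(bin0 M) (leq_trans _ (hmax 1 _)) // bin0 bin1.
exact: hmax.
Qed.

End MaxFaces.

(** What the Taylor complex and L have in common, and all that the asymptotics
    of the numerators depend on. *)
Definition sandwiched q (X : {set {set vertex q 3}}) : Prop := forall n,
  'C('C(q, 3) + q ^ 2 - q, n) <= face_num X (n%:Z - 1)%R <= 'C('C(q, 3) + q ^ 2, n).

Lemma taylor_sandwiched q : sandwiched (taylor q 3).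
Proof. by move=> n; rewrite taylor_faces leqnn andbT leq_bin2l ?leq_subr. Qed.

Lemma L3_sandwiched q (L : {set {set vertex q 3}}) : is_L3 L -> sandwiched L.
Proof.
case=> -[L0 _] _ LT fL n; apply/andP; split; last first.
  rewrite -taylor_faces !face_num_card; apply/subset_leq_card/subsetP => s.
  by move=> /setIdP[sL sn]; rewrite in_set sn (subsetP LT).
case: n => [|n].
  rewrite bin0 face_num_card; apply/card_gt0P; exists set0.
  by rewrite in_set L0 cards0.
have -> : (Posz n.+1 - 1)%R = Posz n by lia.
rewrite fL; have -> : 2 * 'C(q, 2) = q ^ 2 - q.
  by rewrite -mul_bin_diag bin1 -subn1 mulnBr muln1 mulnn.
by rewrite addnBA ?leq_addl // -mulnn; nia.
Qed.

(** Both sides compare with (q + 1) ^ 3. *)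
Lemma succ_card_le q : ('C(q, 3) + q ^ 2).+1 <= 2 ^ (3 * q).
Proof.
apply: (@leq_trans (q.+1 ^ 3)); last by rewrite mulnC expnM leq_exp2r // ltn_expl.
have := bin3_ffact q; have : q * (q - 1) * (q - 2) <= q ^ 3.
  by rewrite !expnS expn0 muln1 mulnA !leq_mul // leq_subr.
have -> : q.+1 ^ 3 = q ^ 3 + 3 * q ^ 2 + 3 * q + 1 by ring.
by lia.
Qed.

Lemma max_face_num_scarf_ge q : 3 <= q ->
  2 ^ 'C(q, 3) <= ('C(q, 3)).+1 * max_face_num (scarf q 3).
Proof.
move=> q3; apply: max_face_num_ge; [by rewrite bin_gt0| |exact: scarf_faces_ge].
by rewrite -card_sqfree max_card.
Qed.

Lemma max_face_num_scarf_gt0 q : 3 <= q -> 0 < max_face_num (scarf q 3).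
Proof.
move=> /max_face_num_scarf_ge; rewrite lt0n; apply: contraTneq => ->.
by rewrite muln0 leqn0 expn_eq0.
Qed.

(** The quotient of the maxima is 2 ^ (q ^ 2) up to a factor 2 ^ (5 q); stated
    without division. *)
Lemma max_face_num_ratio q (X : {set {set vertex q 3}}) : 15 <= q -> sandwiched X ->
  max_face_num X <= 2 ^ (q ^ 2 + 3 * q) * max_face_num (scarf q 3) /\
  2 ^ (q ^ 2) * max_face_num (scarf q 3) <= 2 ^ (5 * q) * max_face_num X.
Proof.
move=> q15 hX.
have NV : 'C(q, 3) + q ^ 2 <= #|vertex q 3| by rewrite -card_Nrq3 max_card.
have q3 : 3 <= q by lia.
have K0 : 0 < 'C(q, 3) by rewrite bin_gt0.
have qq : q <= q ^ 2 by rewrite -mulnn; nia.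
split.
  have XN : max_face_num X <= 1 * 2 ^ ('C(q, 3) + q ^ 2).
    by apply: max_face_num_le => n; rewrite mul1n; case/andP: (hX n).
  have KS := max_face_num_scarf_ge q3.
  apply: leq_trans XN _; rewrite mul1n addnC (expnD 2 (q ^ 2) (3 * q)) expnD.
  rewrite -mulnA leq_mul2l; apply/orP; right.
  apply: leq_trans KS _; rewrite leq_mul2r; apply/orP; right.
  by apply: leq_trans _ (succ_card_le q); rewrite ltnS leq_addr.
have SN := max_face_num_le (fun n => scarf_faces_le n q15).
have XM : 2 ^ ('C(q, 3) + q ^ 2 - q) <= ('C(q, 3) + q ^ 2 - q).+1 * max_face_num X.
  apply: max_face_num_ge => [||n]; last by case/andP: (hX n).
    by rewrite -addnBA // addn_gt0 K0.
  by rewrite (leq_trans (leq_subr _ _)).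
apply: (@leq_trans (2 ^ (2 * q) * 2 ^ ('C(q, 3) + q ^ 2 - q))).
  apply: leq_trans (leq_mul (leqnn _) SN) _; rewrite -!expnD leq_exp2l //; lia.
have -> : 2 ^ (5 * q) = 2 ^ (2 * q) * 2 ^ (3 * q).
  by rewrite -expnD; congr (2 ^ _); lia.
rewrite -mulnA leq_mul2l; apply/orP; right; apply: leq_trans XM _.
rewrite leq_mul2r; apply/orP; right; apply: leq_trans _ (succ_card_le q).
by rewrite ltnS leq_subr.
Qed.

From mathcomp Require Import all_classical all_reals all_analysis.
Import Order.TTheory GRing.Theory Num.Theory.
Import numFieldNormedType.Exports.

Local Open Scope classical_set_scope.
Local Open Scope ring_scope.

(** * Asymptotics *)

Section Asymptotics.
Variable R : realType.
Implicit Types (b c rho D Q : R).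

Lemma exponent_exists b rho Q D : 1 < b -> 0 < rho ->
    rho <= expR D * b `^ Q -> b `^ Q <= expR D * rho ->
  exists2 y, `|y| <= D / ln b & rho = b `^ (Q + y).
Proof.
move=> b1 r0; have b0 : 0 < b by lra.
have l0 : 0 < ln b := ln_gt0 b1.
have pE z : b `^ z = expR (z * ln b) by rewrite mulrC expRM lnK ?posrE.
rewrite pE -[rho]lnK ?posrE // -!expRD !ler_expR => up lo.
exists (ln rho / ln b - Q); last first.
  by rewrite pE addrC subrK divfK ?lnK ?posrE ?gt_eqF.
have -> : ln rho / ln b - Q = (ln rho - Q * ln b) / ln b.
  by rewrite mulrBl mulfK ?gt_eqF.
rewrite normrM normfV (gtr0_norm l0) ler_pM2r ?invr_gt0 // ler_norml.
by apply/andP; split; lra.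
Qed.

Lemma bigO_id_bounded (g : nat -> R) C :
  (forall q, `|g q| <= C * q%:R) -> g =O_\oo (fun q : nat => q%:R : R).
Proof.
move=> gC; apply/eqO_exP; exists (Num.max C 1); first by rewrite lt_max ltr01 orbT.
near=> q; rewrite normr_nat; apply: le_trans (gC q) _.
by rewrite ler_wpM2r // le_max lexx.
Unshelve. all: by end_near. Qed.

Lemma expR_ge2X k : 2 ^+ k <= expR k%:R :> R.
Proof.
rewrite -[k%:R]mulr1 expRM_natl lerXn2r ?nnegrE ?expR_ge0 //.
exact: le_trans (expR_ge1Dx 1).
Qed.

Lemma sqrt_bounds q : (2 <= q)%N -> 1 <= Num.sqrt (1 + 6 / q%:R : R) <= 2.
Proof.
move=> q2; have q0 : 0 < q%:R :> R by rewrite ltr0n; lia.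
have /andP[h0 h3] : 0 <= (6 / q%:R : R) <= 3.
  rewrite divr_ge0 ?ler0n //= ler_pdivrMr //.
  have : 2 <= q%:R :> R by rewrite (ler_nat _ 2).
  lra.
have e4 : Num.sqrt 4 = 2 :> R.
  have -> : 4 = 2 ^+ 2 :> R by ring.
  by rewrite sqrtr_sqr ger0_norm.
by rewrite -e4 -{1}sqrtr1 !ler_wsqrtr //; lra.
Qed.

Lemma max_face_asymptotics (X : forall q, {set {set vertex q 3}}) :
    (forall q, (0 < q)%N -> sandwiched (X q)) ->
  exists g : nat -> R, g =O_\oo (fun q : nat => q%:R : R) /\
    \forall q \near \oo,
      (max_face_num (X q))%:R / (max_face_num (scarf q 3))%:R
        = (2 `^ (q%:R ^+ 2 + g q)) / Num.sqrt (1 + 6 / q%:R).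
Proof.
move=> hX.
have l2 : 0 < ln 2 :> R by apply: ln_gt0; lra.
have /choice[g hg] : forall q, exists y : R, `|y| <= 5 / ln 2 * q%:R /\
    ((15 <= q)%N -> (max_face_num (X q))%:R / (max_face_num (scarf q 3))%:R
        = (2 `^ (q%:R ^+ 2 + y)) / Num.sqrt (1 + 6 / q%:R)).
  move=> q; have [q15|q15] := boolP (15 <= q)%N; last first.
    by exists 0; split=> //; rewrite normr0 mulr_ge0 // divr_ge0 // ltW.
  have q0 : (0 < q)%N by lia.
  have q2 : (2 <= q)%N by lia.
  have [up lo] := max_face_num_ratio q15 (hX q q0).
  have /andP[s1 s2] := sqrt_bounds q2.
  set s := Num.sqrt _ in s1 s2 *; have s0 : 0 < s by lra.
  set F := max_face_num (X q) in up lo *.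
  set S := max_face_num (scarf q 3) in up lo *.
  have S0 : 0 < S%:R :> R by rewrite ltr0n max_face_num_scarf_gt0 //; lia.
  have F0 : 0 < F%:R :> R.
    move: S0 lo; rewrite !ltr0n; case: (F) => //.
    by rewrite muln0 leqn0 muln_eq0 expn_eq0 /= => /lt0n_neq0/negbTE ->.
  have pQ : 2 `^ (q%:R ^+ 2) = 2 ^+ (q ^ 2)%N :> R.
    by rewrite -natrX powR_mulrn.
  have e5 : 2 ^+ (5 * q)%N <= expR (5 * q%:R) :> R.
    by rewrite -natrM expR_ge2X.
  have [||||y yb ye] := @exponent_exists 2 (F%:R / S%:R * s) (q%:R ^+ 2) (5 * q%:R).
  - by lra.
  - by rewrite mulr_gt0 // divr_gt0.
  - rewrite pQ mulrAC ler_pdivrMr //.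
    apply: (@le_trans _ _ (F%:R * 2)); first by rewrite ler_wpM2l.
    move: up; rewrite -(ler_nat R) natrM natrX exprD => up.
    apply: (@le_trans _ _ (2 ^+ (q ^ 2) * 2 ^+ (3 * q) * S%:R * 2)).
      by rewrite ler_wpM2r.
    rewrite mulrAC ler_pM2r // -mulrA mulrC ler_wpM2r ?exprn_ge0 //.
    by apply: le_trans e5; rewrite -exprSr ler_eXn2l //; [lia|lra].
  - rewrite pQ mulrA mulrA mulrAC ler_pdivlMr //.
    move: lo; rewrite -(ler_nat R) !natrM !natrX => lo.
    apply: le_trans lo _; rewrite mulrAC.
    rewrite ler_wpM2r // (le_trans e5) // ler_peMr // expR_ge0.
  exists y; split; first by rewrite mulrAC.
  by move=> _; rewrite -ye mulfK // gt_eqF.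
exists g; split; first by apply: (@bigO_id_bounded _ (5 / ln 2)) => q; case: (hg q).
by near=> q; have [_ ->] := hg q => //; near: q; exact: nbhs_infty_ge.
Unshelve. all: by end_near. Qed.

Lemma bin_ratio_step c K n k : 0 <= c -> c < 1 -> n%:R = c * K%:R :> R -> (K <= k)%N ->
  'C(k.+1, n)%:R * (k.+1%:R - n%:R) = k.+1%:R * 'C(k, n)%:R :> R.
Proof.
move=> c0 c1 nK Kk; have nk : (n <= k)%N.
  rewrite -(ler_nat R) nK (le_trans _ (_ : K%:R <= _)) ?ler_nat //.
  by rewrite ler_piMl // ltW.
by rewrite -natrB ?leqW // -!natrM mulnC -mul_bin_down.
Qed.

(** Each step from K + k to K + k + 1 multiplies the binomial coefficient by
    (K + k + 1) / (K + k + 1 - n), at most 1 / (1 - c) as n <= c (K + k + 1). *)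
Lemma bin_ratio_le c K n m : 0 <= c -> c < 1 -> n%:R = c * K%:R :> R ->
  'C(K + m, n)%:R <= (1 - c)^-1 ^+ m * 'C(K, n)%:R :> R.
Proof.
move=> c0 c1 nK; elim: m => [|m IH]; first by rewrite addn0 expr0 mul1r.
rewrite addnS exprS -mulrA; apply: le_trans (ler_wpM2l _ IH); last by rewrite invr_ge0; lra.
rewrite ler_pdivlMl; last by lra.
have := bin_ratio_step c0 c1 nK (leq_addr m K); set k := (K + m)%N => e.
have Kk : K%:R <= k.+1%:R :> R by rewrite ler_nat leqW // leq_addr.
have k0 : 0 < k.+1%:R :> R by rewrite ltr0n.
rewrite -(ler_pM2l k0) -e mulrA mulrC ler_wpM2l // mulrBr mulr1 lerB //.
by rewrite nK mulrC ler_wpM2r.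
Qed.

(** Each step loses against 1 / (1 - c) a factor
    1 + c (k + 1) / ((1 - c) (K + k + 1)), at most expR (c M / ((1 - c) K)). *)
Lemma bin_ratio_ge c K n m M : 0 <= c -> c < 1 -> n%:R = c * K%:R :> R -> (0 < K)%N ->
    (m <= M)%N ->
  (1 - c)^-1 ^+ m * 'C(K, n)%:R
    <= expR (c / (1 - c) * (M%:R / K%:R)) ^+ m * 'C(K + m, n)%:R :> R.
Proof.
move=> c0 c1 nK K0; set E := expR _; elim: m => [|m IH] mM; first by rewrite addn0 !expr0.
rewrite addnS !exprS -!mulrA.
have d0 : 0 < 1 - c by lra.
apply: le_trans (ler_wpM2l _ (IH (ltnW mM))) _; first by rewrite invr_ge0 ltW.
rewrite mulrCA [leRHS]mulrCA ler_wpM2l ?exprn_ge0 ?expR_ge0 //.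
rewrite ler_pdivrMl //.
have := bin_ratio_step c0 c1 nK (leq_addr m K); set k := (K + m)%N => e.
have k0 : 0 < k.+1%:R :> R by rewrite ltr0n.
have Kp : 0 < K%:R :> R by rewrite ltr0n.
rewrite -(ler_pM2l k0) -e [leRHS](_ : _ = 'C(k.+1, n)%:R * (k.+1%:R * (1 - c) * E)); last by ring.
rewrite ler_wpM2l // nK.
apply: (@le_trans _ _ (k.+1%:R * (1 - c) * (1 + c / (1 - c) * (M%:R / K%:R)))); last first.
  by rewrite ler_wpM2l ?expR_ge1Dx // mulr_ge0 // ltW.
have -> : k.+1%:R * (1 - c) * (1 + c / (1 - c) * (M%:R / K%:R)) =
    k.+1%:R * (1 - c) + c * (M%:R * (k.+1%:R / K%:R)) by field; lra.
have kK : k.+1%:R = K%:R + m.+1%:R :> R by rewrite -natrD addnS.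
have mMR : m.+1%:R <= M%:R :> R by rewrite ler_nat.
have h : k.+1%:R - K%:R <= M%:R * (k.+1%:R / K%:R) :> R.
  apply: (@le_trans _ _ M%:R); first by rewrite kK; lra.
  by rewrite ler_peMr // ler_pdivlMr // mul1r kK lerDl.
have := ler_wpM2l c0 h; lra.
Qed.

(** The lower bound loses a factor 2 ^ q in the denominator, q of the q ^ 2
    factors because the numerator may be that of L, and q ^ 2 times an
    exponent of order q ^ 2 / K, where K >= q ^ 3 / 12. *)
Lemma face_ratio_bounds q (X : {set {set vertex q 3}}) c n :
    (15 <= q)%N -> sandwiched X -> 0 <= c -> c < 1 ->
    n%:R = c * 'C(q, 3)%:R :> R ->
  [/\ 0 < (face_num X (n%:Z - 1))%:R / (face_num (scarf q 3) (n%:Z - 1))%:R :> R,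
      (face_num X (n%:Z - 1))%:R / (face_num (scarf q 3) (n%:Z - 1))%:R
        <= (1 - c)^-1 ^+ (q ^ 2)%N &
      (1 - c)^-1 ^+ (q ^ 2)%N <= (1 - c)^-1 ^+ q * expR ((1 + 12 * c / (1 - c)) * q%:R) *
      ((face_num X (n%:Z - 1))%:R / (face_num (scarf q 3) (n%:Z - 1))%:R)].
Proof.
move=> q15 hX c0 c1 nK; set f := face_num X _; set s := face_num _ _.
have d0 : 0 < 1 - c by lra.
have b0 : 0 <= (1 - c)^-1 by rewrite invr_ge0 ltW.
have /andP[fl fu] := hX n; rewrite -/f in fl fu.
have su := scarf_faces_le n q15; have sl := scarf_faces_ge q n; rewrite -/s in su sl.
have q0 : 0 < q%:R :> R by rewrite ltr0n; lia.
have K12 : (q ^ 3 <= 12 * 'C(q, 3))%N.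
  rewrite (_ : (12 * 'C(q, 3))%N = (2 * (6 * 'C(q, 3)))%N); last by lia.
  rewrite bin3_ffact; have -> : q = (q - 15 + 15)%N by rewrite subnK.
  move: (q - 15)%N => z; rewrite -!addnBA //; nia.
have Kpos : (0 < 'C(q, 3))%N by rewrite bin_gt0; lia.
have nleK : (n <= 'C(q, 3))%N by rewrite -(ler_nat R) nK ler_piMl // ltW.
have C0 : (0 < 'C('C(q, 3), n))%N by rewrite bin_gt0.
have s0 : 0 < s%:R :> R by rewrite ltr0n (leq_trans C0).
have qq : (q <= q ^ 2)%N by rewrite -mulnn; nia.
have f0 : 0 < f%:R :> R.
  by rewrite ltr0n (leq_trans _ fl) // bin_gt0 (leq_trans nleK) // -addnBA // leq_addr.
split; first by rewrite divr_gt0.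
  rewrite ler_pdivrMr //; apply: (@le_trans _ _ 'C('C(q, 3) + q ^ 2, n)%:R).
    by rewrite ler_nat.
  apply: le_trans (bin_ratio_le _ c0 c1 nK) _.
  by rewrite ler_wpM2l ?exprn_ge0 // ler_nat.
rewrite mulrA ler_pdivlMr //.
have lo := @bin_ratio_ge c _ n (q ^ 2 - q) (q ^ 2) c0 c1 nK Kpos (leq_subr _ _).
rewrite addnBA // in lo.
have -> : (q ^ 2 = q + (q ^ 2 - q))%N by rewrite subnKC.
rewrite exprD -!mulrA ler_wpM2l ?exprn_ge0 //.
apply: (@le_trans _ _ (2 ^+ q * ((1 - c)^-1 ^+ (q ^ 2 - q) * 'C('C(q, 3), n)%:R))).
  rewrite [leRHS]mulrCA ler_wpM2l ?exprn_ge0 //.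
  by move: su; rewrite -(ler_nat R) natrM natrX.
rewrite mulrDl mul1r expRD -[leRHS]mulrA ler_pM ?mulr_ge0 ?exprn_ge0 ?expR_ge2X //.
apply: le_trans lo _; rewrite ler_pM ?exprn_ge0 ?expR_ge0 ?ler_nat //.
rewrite -expRM_natl ler_expR.
have q2 : (q ^ 2 - q)%N%:R <= q%:R ^+ 2 :> R by rewrite -natrX ler_nat leq_subr.
have Kp : 0 < 'C(q, 3)%:R :> R by rewrite ltr0n.
have cb : 0 <= c / (1 - c) by rewrite divr_ge0 // ltW.
apply: (@le_trans _ _ (q%:R ^+ 2 * (c / (1 - c) * (q%:R ^+ 2 / 'C(q, 3)%:R)))).
  by rewrite natrX ler_wpM2r // mulr_ge0 // divr_ge0 ?exprn_ge0.
rewrite [leLHS](_ : _ = (c / (1 - c)) * (q%:R * (q%:R ^+ 3 / 'C(q, 3)%:R))); last first.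
  by field; rewrite gt_eqF //= gt_eqF.
rewrite [leRHS](_ : _ = (c / (1 - c)) * (q%:R * 12)); last by ring.
rewrite ler_wpM2l // ler_wpM2l ?ler0n // ler_pdivrMr //.
by rewrite -natrX -natrM ler_nat.
Qed.

Lemma scarf_fraction_index q c (i : int) : (15 <= q)%N -> 0 <= c ->
    i%:~R = c * (dim_complex (scarf q 3) + 1)%:~R ->
  exists2 n : nat, i = n%:Z & n%:R = c * 'C(q, 3)%:R :> R.
Proof.
move=> q15 c0; rewrite dim_scarf // -pmulrn => ic.
have : 0 <= i by rewrite -(ler0z R) ic mulr_ge0.
by case: i ic => // n nc _; exists n; rewrite // -nc -pmulrn.
Qed.

Lemma face_asymptotics (X : forall q, {set {set vertex q 3}}) c :
    (forall q, (0 < q)%N -> sandwiched (X q)) -> 0 <= c -> c < 1 ->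
  exists g h : nat -> R,
    [/\ g =O_\oo (fun q : nat => q%:R : R),
        h =O_\oo (fun q : nat => expR (- (3 * c * q%:R) / (1 - c)) : R) &
        \forall q \near \oo, forall i : int,
          i%:~R = c * (dim_complex (scarf q 3) + 1)%:~R ->
          (face_num (X q) (i - 1))%:R / (face_num (scarf q 3) (i - 1))%:R
            = ((1 / (1 - c)) `^ (q%:R ^+ 2 + g q)) * h q].
Proof.
move=> hX c0 c1; have d0 : 0 < 1 - c by lra.
have [c_eq0|c_neq0] := eqVneq c 0.
  (* Only the empty face is counted, and the base 1 / (1 - c) is 1. *)
  exists (fun=> 0).
  exists (fun q => (face_num (X q) (0 - 1))%:R / (face_num (scarf q 3) (0 - 1))%:R).
  split.
  - by apply: (@bigO_id_bounded _ 0) => q; rewrite normr0 mul0r.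
  - apply/eqO_exP; exists 1 => //; near=> q.
    have q15 : (15 <= q)%N by near: q; exact: nbhs_infty_ge.
    have q0 : (0 < q)%N by lia.
    have n0 : 0%N%:R = c * 'C(q, 3)%:R :> R by rewrite c_eq0 mul0r.
    have [r0 r1 _] := face_ratio_bounds q15 (hX q q0) c0 c1 n0.
    rewrite gtr0_norm // mul1r (le_trans r1) //.
    by rewrite c_eq0 subr0 invr1 expr1n mulr0 mul0r oppr0 mul0r expR0 normr1.
  - near=> q => i; rewrite c_eq0 mul0r => /eqP; rewrite intr_eq0 => /eqP ->.
    by rewrite subr0 divr1 powR1 mul1r.
have cp : 0 < c by rewrite lt_def c_neq0.
set b := 1 / (1 - c); have b1 : 1 < b by rewrite /b div1r invf_gt1 //; lra.
have bE : b = (1 - c)^-1 by rewrite /b div1r.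
have lb0 : 0 < ln b := ln_gt0 b1.
(* The three losses: the first two come from [face_ratio_bounds], the last from
   dividing by h. *)
pose D : R := ln b + (1 + 12 * c / (1 - c)) + 3 * c / (1 - c).
have cd0 : 0 <= c / (1 - c) by rewrite divr_ge0 // ltW.
have D0 : 0 <= D by rewrite /D -!mulrA; lra.
pose h (q : nat) : R := expR (- (3 * c * q%:R) / (1 - c)).
have /choice[g hg] : forall q, exists y : R, `|y| <= D / ln b * q%:R /\
    ((15 <= q)%N -> forall i : int, i%:~R = c * (dim_complex (scarf q 3) + 1)%:~R ->
      (face_num (X q) (i - 1))%:R / (face_num (scarf q 3) (i - 1))%:R
        = b `^ (q%:R ^+ 2 + y) * h q).
  (* The ratio matters only for the q for which c * 'C(q, 3) is an integer, and
     it is the only candidate for i; g is 0 elsewhere. *)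
  move=> q; have [[q15 [i ic]]|no] :=
      pselect ((15 <= q)%N /\ exists i : int, i%:~R = c * (dim_complex (scarf q 3) + 1)%:~R);
    last first.
    exists 0; rewrite normr0 mulr_ge0 // ?divr_ge0 // 1?ltW //; split=> // q15 i ic.
    by case: no; split=> //; exists i.
  have q0 : (0 < q)%N by lia.
  have [n ein nK] := scarf_fraction_index q15 c0 ic.
  have := face_ratio_bounds q15 (hX q q0) c0 c1 nK; rewrite -bE -ein.
  set rho := _ / _ => -[r0 up lo].
  have pQ : b `^ (q%:R ^+ 2) = b ^+ (q ^ 2)%N.
    by rewrite -natrX powR_mulrn //; lra.
  have h0 : 0 < h q := expR_gt0 _.
  have hV : (h q)^-1 = expR (3 * c / (1 - c) * q%:R).
    by rewrite -expRN /h; congr expR; ring.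
  have [||||y yb ye] := @exponent_exists b (rho / h q) (q%:R ^+ 2) (D * q%:R).
  - by [].
  - by rewrite divr_gt0.
  - rewrite pQ hV mulrC ler_pM ?expR_ge0 ?(ltW r0) // ler_expR ler_wpM2r //.
    by rewrite /D -!mulrA; lra.
  - rewrite pQ hV (le_trans lo) //.
    rewrite [leRHS](_ : _ = expR (D * q%:R) * expR (3 * c / (1 - c) * q%:R) * rho); last by ring.
    have bq : b ^+ q = expR (ln b * q%:R).
      by rewrite expRM_natr lnK // posrE; lra.
    rewrite ler_wpM2r ?(ltW r0) // bq -!expRD ler_expR -!mulrDl ler_wpM2r //.
    by rewrite /D bE -!mulrA; lra.
  exists y; split; first by rewrite mulrAC.
  move=> _ j jc; have -> : j = i.
    by apply: (@intr_inj R); rewrite ic jc.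
  by rewrite -/rho -ye divfK // gt_eqF.
exists g, h; split.
- by apply: (@bigO_id_bounded _ (D / ln b)) => q; case: (hg q).
- by apply/eqO_exP; exists 1 => //; near=> q; rewrite mul1r.
- by near=> q; have [_ +] := hg q; apply; near: q; exact: nbhs_infty_ge.
Unshelve. all: by end_near. Qed.

End Asymptotics.

Theorem theorem8p4 (R : realType) :
  ((exists g : nat -> R,
      g =O_\oo (fun q : nat => q%:R : R) /\
      \forall q \near \oo,
        (max_face_num (taylor q 3))%:R / (max_face_num (scarf q 3))%:R
          = (2 `^ (q%:R ^+ 2 + g q)) / Num.sqrt (1 + 6 / q%:R)) /\
   (forall L : forall q : nat, {set {set vertex q 3}},
      (forall q : nat, (0 < q)%N -> is_L3 (L q)) ->
    exists g : nat -> R,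
      g =O_\oo (fun q : nat => q%:R : R) /\
      \forall q \near \oo,
        (max_face_num (L q))%:R / (max_face_num (scarf q 3))%:R
          = (2 `^ (q%:R ^+ 2 + g q)) / Num.sqrt (1 + 6 / q%:R))) /\
  (forall c : R, 0 <= c -> c < 1 ->
   (exists g h : nat -> R,
      [/\ g =O_\oo (fun q : nat => q%:R : R),
          h =O_\oo (fun q : nat => expR (- (3 * c * q%:R) / (1 - c)) : R) &
          \forall q \near \oo, forall i : int,
            i%:~R = c * (dim_complex (scarf q 3) + 1)%:~R ->
            (face_num (taylor q 3) (i - 1))%:R
                / (face_num (scarf q 3) (i - 1))%:R
              = ((1 / (1 - c)) `^ (q%:R ^+ 2 + g q)) * h q]) /\
   (forall L : forall q : nat, {set {set vertex q 3}},
      (forall q : nat, (0 < q)%N -> is_L3 (L q)) ->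
    exists g h : nat -> R,
      [/\ g =O_\oo (fun q : nat => q%:R : R),
          h =O_\oo (fun q : nat => expR (- (3 * c * q%:R) / (1 - c)) : R) &
          \forall q \near \oo, forall i : int,
            i%:~R = c * (dim_complex (scarf q 3) + 1)%:~R ->
            (face_num (L q) (i - 1))%:R
                / (face_num (scarf q 3) (i - 1))%:R
              = ((1 / (1 - c)) `^ (q%:R ^+ 2 + g q)) * h q])).
Proof.
have hT q : (0 < q)%N -> sandwiched (taylor q 3) by move=> _; apply: taylor_sandwiched.
have hL (L : forall q : nat, {set {set vertex q 3}}) :
    (forall q : nat, (0 < q)%N -> is_L3 (L q)) ->
  forall q, (0 < q)%N -> sandwiched (L q).
  by move=> LP q /LP; apply: L3_sandwiched.
split; first by split=> [|L /hL]; apply: max_face_asymptotics.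
move=> c c0 c1; split=> [|L /hL LP]; exact: face_asymptotics.
Qed.
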